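(* There exist a finite or compact Lie group $G$, tensors $A$ and $B$ of square matrices of equal size with finite-dimensional physical spaces $\mathcal{H}_A$ and $\mathcal{H}_B$, a unitary representation $\Theta$ of $G$ on $\mathcal{H}_A$ and projective unitary representations $\mathcal{R},\mathcal{L}$ of $G$ on $\mathcal{H}_B$ with inverse multipliers, such that: (i) $|\psi_{AB}\rangle$ has a local symmetry with respect to $\mathcal{R}(g)\otimes\Theta(g)\otimes\mathcal{L}(g)$, i.e. for all $N\ge2$, all sites $2K,2K+1,2K+2$ of the periodic chain of length $2N$ and all $g\in G$, $\mathcal{R}(g)^{[2K]}\otimes\Theta(g)^{[2K+1]}\otimes\mathcal{L}(g)^{[2K+2]}|\psi^N_{AB}\rangle=|\psi^N_{AB}\rangle$; (ii) $|\psi_A\rangle$ does not have a global symmetry with respect to $\Theta$, i.e. it is not the case that $\Theta(g)^{\otimes N}|\psi^N_A\rangle=|\psi^N_A\rangle$ for all $N\in\mathbb{N}$ and all $g\in G$; (iii) $\mathcal{R}(g)\otimes\mathcal{L}(g)|\psi_B\rangle\ne|\psi_B\rangle$, i.e. it is not the case that $\mathcal{R}(g)^{[K]}\otimes\mathcal{L}(g)^{[K+1]}|\psi^N_B\rangle=|\psi^N_B\rangle$ for all $N\ge2$, all neighboring sites $K,K+1$ and all $g\in G$.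
   Context: A projective unitary representation of $G$ with multiplier $\gamma:G\times G\to U(1)$ is a map $\Theta$ from $G$ to unitaries with $\Theta(g)\Theta(h)=\gamma(g,h)\Theta(gh)$, where $\gamma(g,h)\gamma(gh,f)=\gamma(g,hf)\gamma(h,f)$ and $\gamma(g,e)=\gamma(e,g)=1$; a unitary representation has $\gamma\equiv1$. A tensor $A=\{A^i\}$ of square matrices generates $|\psi_A^N\rangle=\sum\operatorname{Tr}(A^{i_1}\cdots A^{i_N})|i_1\dots i_N\rangle$ (similarly for $B$), and $A,B$ together generate $|\psi^N_{AB}\rangle=\sum\operatorname{Tr}(A^{i_1}B^{j_1}\cdots A^{i_N}B^{j_N})|i_1j_1\dots i_Nj_N\rangle$, where odd sites carry $\mathcal{H}_A$, even sites carry $\mathcal{H}_B$, and sites are labelled modulo $2N$. A superscript $[K]$ indicates the site on which an operator acts. *)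

(* Defs.v *)
From HB Require Import structures.
From mathcomp Require Import all_boot all_order all_algebra.
From mathcomp Require Import boolp classical_sets functions cardinality.
From mathcomp Require Import reals topology normedtype derive.
From mathcomp Require Import complex.

Set Implicit Arguments.
Unset Strict Implicit.
Unset Printing Implicit Defensive.

Import Order.TTheory GRing.Theory Num.Theory numFieldNormedType.Exports.

Local Open Scope classical_set_scope.
Local Open Scope ring_scope.

HB.mixin Record Group_isTopologicalGroup G of Group G & Topological G := {
  mulg_continuous : continuous (fun x : G * G => (x.1 * x.2)%g);
  invg_continuous : continuous (fun x : G => x^-1%g)
}.

#[short(type="topologicalGroupType")]
HB.structure Definition TopologicalGroup :=
  {G of Group_isTopologicalGroup G & Group G & Topological G}.

(* Only meaningful for open U and finite-dimensional V. *)
Fixpoint Ck (R : realType) (V W : normedModType R) (k : nat) (U : set V)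
    (f : V -> W) : Prop :=
  match k with
  | 0%N => forall x, U x -> {for x, continuous f}
  | k'.+1 => (forall x, U x -> differentiable f x) /\
             (forall v, Ck k' U (fun x => 'D_v f x))
  end.

Definition smooth_on (R : realType) (V W : normedModType R) (U : set V)
    (f : V -> W) : Prop := forall k, Ck k U f.

(* The values of chart_fun and chart_inv outside chart_dom and chart_cod are
   irrelevant. *)
Record chart (R : realType) (G : topologicalType) (n : nat) := Chart {
  chart_dom : set G;
  chart_cod : set 'rV[R]_n;
  chart_fun : G -> 'rV[R]_n;
  chart_inv : 'rV[R]_n -> G;
  chart_dom_open : open chart_dom;
  chart_cod_open : open chart_cod;
  chart_funS : forall x, chart_dom x -> chart_cod (chart_fun x);
  chart_invS : forall y, chart_cod y -> chart_dom (chart_inv y);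
  chart_funK : forall x, chart_dom x -> chart_inv (chart_fun x) = x;
  chart_invK : forall y, chart_cod y -> chart_fun (chart_inv y) = y;
  chart_fun_continuous :
    forall x, chart_dom x -> {for x, continuous chart_fun};
  chart_inv_continuous :
    forall y, chart_cod y -> {for y, continuous chart_inv}
}.

(* Second countability is not listed: it follows from compactness and the
   existence of charts. *)
Definition compact_Lie_group (R : realType) (G : topologicalGroupType) : Prop :=
  [/\ compact [set: G], hausdorff_space G &
    exists (n : nat) (At : set (chart R G n)),
      [/\ forall x : G, exists2 c, At c & chart_dom c x,
          forall c c', At c -> At c' ->
            smooth_on
              [set y | chart_cod c y /\ chart_dom c' (chart_inv c y)]
              (fun y => chart_fun c' (chart_inv c y)),
          forall c1 c2 c', At c1 -> At c2 -> At c' ->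
            smooth_on
              [set y : 'rV[R]_n * 'rV[R]_n |
                [/\ chart_cod c1 y.1, chart_cod c2 y.2 &
                    chart_dom c' (chart_inv c1 y.1 * chart_inv c2 y.2)%g]]
              (fun y => chart_fun c' (chart_inv c1 y.1 * chart_inv c2 y.2)%g) &
          forall c c', At c -> At c' ->
            smooth_on
              [set y | chart_cod c y /\ chart_dom c' (chart_inv c y)^-1%g]
              (fun y => chart_fun c' (chart_inv c y)^-1%g)]].

Definition finite_or_compact_Lie (R : realType) (G : topologicalGroupType) :
    Prop :=
  finite_set [set: G] \/ compact_Lie_group R G.

Definition is_multiplier (R : realType) (G : groupType) (gam : G -> G -> R[i]) :
    Prop :=
  [/\ forall g h, `|gam g h| = 1,
      forall g h f, gam g h * gam (g * h)%g f = gam g (h * f)%g * gam h f &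
      forall g, gam g 1%g = 1 /\ gam 1%g g = 1].

Definition is_proj_unitary_rep (R : realType) (G : groupType) (d : nat)
    (gam : G -> G -> R[i]) (T : G -> 'M[R[i]]_d) : Prop :=
  [/\ is_multiplier gam,
      forall g, T g \is unitarymx &
      forall g h, T g *m T h = gam g h *: T (g * h)%g].

Definition is_unitary_rep (R : realType) (G : groupType) (d : nat)
    (T : G -> 'M[R[i]]_d) : Prop :=
  is_proj_unitary_rep (fun _ _ => 1) T.

(* Vectors of (C^d)^{\otimes N} are given by their coefficients in the product
   basis, indexed by the configurations. *)
Notation conf d N := {ffun 'I_N -> 'I_d}.

Definition set_site (d N : nat) (s : conf d N) (k : 'I_N) (i : 'I_d) :
    conf d N :=
  [ffun l => if l == k then i else s l].

Definition on_site (R : realType) (d N : nat) (O : 'M[R[i]]_d) (k : 'I_N)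
    (psi : {ffun conf d N -> R[i]}) : {ffun conf d N -> R[i]} :=
  [ffun s : conf d N => \sum_(i < d) O (s k) i * psi (set_site s k i)].

Definition on_all_sites (R : realType) (d N : nat) (O : 'M[R[i]]_d)
    (psi : {ffun conf d N -> R[i]}) : {ffun conf d N -> R[i]} :=
  [ffun s : conf d N => \sum_(t : conf d N) (\prod_(k < N) O (s k) (t k)) * psi t].

Definition mps (R : realType) (D d N : nat) (A : 'I_d -> 'M[R[i]]_D) :
    {ffun conf d N -> R[i]} :=
  [ffun s : conf d N => \tr (\prod_(k < N) A (s k))].

(* The chain of length 2N with alternating site spaces C^dA and C^dB.  With
   sites labelled from 1 modulo 2N, the entry k : 'I_N of the first component
   of a configuration is site 2k+1 and that of the second is site 2k+2. *)
Notation conf2 dA dB N := (conf dA N * conf dB N)%type.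

Definition on_odd_site (R : realType) (dA dB N : nat) (O : 'M[R[i]]_dA)
    (k : 'I_N) (psi : {ffun conf2 dA dB N -> R[i]}) :
    {ffun conf2 dA dB N -> R[i]} :=
  [ffun s : conf2 dA dB N => on_site O k [ffun a : conf dA N => psi (a, s.2)] s.1].

Definition on_even_site (R : realType) (dA dB N : nat) (O : 'M[R[i]]_dB)
    (k : 'I_N) (psi : {ffun conf2 dA dB N -> R[i]}) :
    {ffun conf2 dA dB N -> R[i]} :=
  [ffun s : conf2 dA dB N => on_site O k [ffun b : conf dB N => psi (s.1, b)] s.2].

Definition mps2 (R : realType) (D dA dB N : nat) (A : 'I_dA -> 'M[R[i]]_D)
    (B : 'I_dB -> 'M[R[i]]_D) : {ffun conf2 dA dB N -> R[i]} :=
  [ffun s : conf2 dA dB N => \tr (\prod_(k < N) (A (s.1 k) *m B (s.2 k)))].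

(* For site 2k+1, the left neighbour 2k is the even site with index k-1 modulo
   N and the right neighbour 2k+2 the one with index k.  These are distinct as
   N >= 2, so the composition below is the tensor product of the operators. *)
Definition has_local_symmetry (R : realType) (G : groupType) (D dA dB : nat)
    (A : 'I_dA -> 'M[R[i]]_D) (B : 'I_dB -> 'M[R[i]]_D)
    (Rr : G -> 'M[R[i]]_dB) (T : G -> 'M[R[i]]_dA) (L : G -> 'M[R[i]]_dB) :
    Prop :=
  forall N : nat, (2 <= N)%N -> forall (k : 'I_N) (g : G),
    on_even_site (Rr g) (ord_pred k)
      (on_odd_site (T g) k (on_even_site (L g) k (mps2 N A B)))
    = mps2 N A B.

Definition has_global_symmetry (R : realType) (G : groupType) (D d : nat)
    (A : 'I_d -> 'M[R[i]]_D) (T : G -> 'M[R[i]]_d) : Prop :=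
  forall N : nat, (1 <= N)%N -> forall g : G,
    on_all_sites (T g) (mps N A) = mps N A.

Definition has_neighbour_symmetry (R : realType) (G : groupType) (D d : nat)
    (B : 'I_d -> 'M[R[i]]_D) (Rr L : G -> 'M[R[i]]_d) : Prop :=
  forall N : nat, (2 <= N)%N -> forall (k : 'I_N) (g : G),
    on_site (Rr g) k (on_site (L g) (ordS k) (mps N B)) = mps N B.

(* Main.v *)
(* Over the group Z/2 take A = B to be the bond-dimension-2 tensor of the GHZ
   state, and let the nontrivial element act through Theta = R = Pauli Z and
   L = 1.  The pair Z Z stabilises the GHZ state |0...0> + |1...1> on the chain
   of length 2N, which is the local symmetry; but Z on a single site, and Z on
   every site when N is odd, turn it into |0...0> - |1...1>. *)

Require Import Defs.
From HB Require Import structures.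
From mathcomp Require Import all_boot all_algebra reals complex.
From mathcomp Require Import classical_sets cardinality topology.

Set Implicit Arguments.
Unset Strict Implicit.
Unset Printing Implicit Defensive.

Import GRing.Theory Num.Theory.

Local Open Scope ring_scope.

(** An alias of [bool] that carries the group law [addb]. The neutral element is [false], and each
    element is its own inverse. *)
Definition Z2 : Type := bool.

HB.instance Definition _ := Finite.copy Z2 bool.
HB.instance Definition _ := DiscreteTopology.copy Z2 bool.
HB.instance Definition _ := isGroup.Build Z2
  addbA addFb addbF addbb addbb.

Lemma Z2_mulg_continuous : continuous (fun x : Z2 * Z2 => (x.1 * x.2)%g).
Proof.
move=> [x y] U /nbhs_singleton /= Uxy.
exists ([set x], [set y])%classic; first by split; exact: discrete_set1.
by move=> [? ?] /= [-> ->].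
Qed.

Lemma Z2_invg_continuous : continuous (fun x : Z2 => x^-1%g).
Proof. by move=> x U. Qed.

HB.instance Definition _ := Group_isTopologicalGroup.Build Z2
  Z2_mulg_continuous Z2_invg_continuous.

Lemma prod_diag_mx (K : comNzRingType) D (I : Type) (r : seq I)
    (v : I -> 'rV[K]_D) :
  \prod_(k <- r) diag_mx (v k) = diag_mx (\row_j \prod_(k <- r) v k 0 j).
Proof.
elim: r => [|k r IH].
  by apply/matrixP=> i j; rewrite big_nil !mxE big_nil.
rewrite big_cons IH -[_ * _]/(_ *m _) mulmx_diag; congr diag_mx.
by apply/rowP => j; rewrite !mxE big_cons.
Qed.

Section Operators.
Variable R : realType.

Lemma on_site_diag d N (v : 'rV[R[i]]_d) (k : 'I_N) psi s :
  on_site (diag_mx v) k psi s = v 0 (s k) * psi s.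
Proof.
rewrite ffunE (bigD1 (s k)) //= big1 => [|j /negPf jk]; last first.
  by rewrite mxE eq_sym jk mul0r.
rewrite mxE eqxx addr0; congr (_ * psi _).
by apply/ffunP => l; rewrite ffunE; case: eqP => [->|].
Qed.

Lemma on_all_sites_diag d N (v : 'rV[R[i]]_d)
    (psi : {ffun conf d N -> R[i]}) s :
  on_all_sites (diag_mx v) psi s = (\prod_k v 0 (s k)) * psi s.
Proof.
rewrite ffunE (bigD1 s) //= [X in _ + X]big1 => [|t /eqP ts]; last first.
  have [k sk] : exists k, s k != t k.
    apply/existsP/contraT; rewrite negb_exists => /forallP h; case: ts.
    by apply/ffunP => k; move/negPn/eqP: (h k).
  by rewrite (bigD1 k) //= mxE (negPf sk) !mul0r.
by rewrite addr0; congr (_ * _); apply: eq_bigr => k _; rewrite mxE eqxx.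
Qed.

(** The projector $|i\rangle\langle i|$, kept in diagonal form so that the traces of products become
    sums over $j$ of products of Kronecker deltas. *)
Definition ghz d (i : 'I_d) : 'M[R[i]]_d := diag_mx (delta_mx 0 i).

Lemma mps_ghz d N (s : conf d N) :
  mps N (@ghz d) s = \sum_j \prod_k (s k == j)%:R.
Proof.
rewrite ffunE prod_diag_mx mxtrace_diag; apply: eq_bigr => j _.
by rewrite mxE; apply: eq_bigr => k _; rewrite mxE eqxx eq_sym.
Qed.

Lemma mps2_ghz d N (s : conf2 d d N) :
  mps2 N (@ghz d) (@ghz d) s =
  \sum_j \prod_k ((s.1 k == j)%:R * (s.2 k == j)%:R).
Proof.
rewrite ffunE; under eq_bigr do rewrite mulmx_diag.
rewrite prod_diag_mx mxtrace_diag; apply: eq_bigr => j _.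
by rewrite mxE; apply: eq_bigr => k _; rewrite !mxE !eqxx !(eq_sym j).
Qed.

(** No $j$ equals both [s.1 k] and [s.2 l], so every summand contains a vanishing delta. *)
Lemma mps2_ghz_eq0 d N (s : conf2 d d N) k l :
  s.1 k != s.2 l -> mps2 N (@ghz d) (@ghz d) s = 0.
Proof.
move=> skl; rewrite mps2_ghz big1 // => j _.
have [jk|jk] := eqVneq (s.1 k) j.
  by rewrite (bigD1 l) //= -jk (eq_sym (s.2 l)) (negPf skl) mulr0 mul0r.
by rewrite (bigD1 k) //= (negPf jk) !mul0r.
Qed.

Lemma mps_ghz_const d N (i : 'I_d) :
  (0 < N)%N -> mps N (@ghz d) [ffun=> i] = 1.
Proof.
case: N => // N _; rewrite mps_ghz (bigD1 i) //=.
rewrite !big1 ?addr0 // => [j ji | k _].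
  by rewrite big_ord_recl ffunE eq_sym (negPf ji) mul0r.
by rewrite ffunE eqxx.
Qed.

(** The diagonal of $Z^g$, with the boolean [g] read as 0 or 1. *)
Definition Zdiag (g : Z2) : 'rV[R[i]]_2 := \row_j (-1) ^+ (g * j)%N.

Definition Zrep (g : Z2) : 'M[R[i]]_2 := diag_mx (Zdiag g).

Lemma trivial_multiplier (G : groupType) :
  is_multiplier (fun _ _ : G => 1 : R[i]).
Proof. by split=> // *; rewrite normr1. Qed.

Lemma trivial_rep (G : groupType) d :
  is_unitary_rep (fun _ : G => 1%:M : 'M[R[i]]_d).
Proof.
split=> [|g|g h]; first exact: trivial_multiplier.
  by apply/unitarymxP; rewrite trmx1 map_mx1 mulmx1.
by rewrite mulmx1 scale1r.
Qed.

Lemma Zrep_unitary : is_unitary_rep Zrep.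
Proof.
have Zm g h : Zrep g *m Zrep h = Zrep (g * h)%g.
  rewrite mulmx_diag; congr diag_mx; apply/rowP => j; rewrite !mxE.
  (* The group law is addition modulo 2, so the exponents agree only in parity, which determines the
     sign. *)
  by rewrite -exprD -mulnDl -[LHS]signr_odd -[RHS]signr_odd !oddM oddD !oddb.
split=> [|g|g h]; first exact: trivial_multiplier; last by rewrite scale1r Zm.
apply/unitarymxP.
(* [Zrep g] is real and diagonal, hence self-adjoint, so unitarity follows from [Zm] and $g^2=e$. *)
have -> : ((Zrep g)^t*)%sesqui = Zrep g.
  apply/matrixP => i j; rewrite !mxE eq_sym.
  by case: eqP => [->|_]; rewrite ?mulr1n ?mulr0n ?conjC0 // rmorphXn rmorphN1.
by rewrite Zm; case: g; apply/matrixP=> i j; rewrite !mxE expr0.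
Qed.

Lemma ghz_local_symmetry :
  has_local_symmetry (@ghz 2) (@ghz 2) Zrep Zrep (fun _ => 1%:M).
Proof.
move=> N _ k g; apply/ffunP => s.
rewrite ffunE on_site_diag ffunE /= ffunE /= on_site_diag ffunE /= ffunE /=.
rewrite -diag_const_mx on_site_diag ffunE /= !mxE mul1r mulrA.
(* The two signs come from these two sites: if their values agree the signs cancel, otherwise the
   amplitude is zero. *)
have [sk|sk] := eqVneq (s.1 k) (s.2 (ord_pred k)); last first.
  by rewrite -surjective_pairing (mps2_ghz_eq0 sk) mulr0.
by rewrite sk -signr_odd -expr2 sqrr_sign mul1r -surjective_pairing.
Qed.

Lemma ghz_no_global_symmetry : ~ has_global_symmetry (@ghz 2) Zrep.
Proof.
(* The amplitude of $|1\dots1\rangle$ is multiplied by $(-1)^N$, so an odd length such as $N=1$ is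
   required. *)
move=> /(_ 1%N isT true) /ffunP /(_ [ffun=> 1]); apply/eqP.
rewrite on_all_sites_diag mps_ghz_const // big_ord1 ffunE mxE mulr1 expr1.
by rewrite eq_sym -addr_eq0 -mulr2n pnatr_eq0.
Qed.

Lemma ghz_no_neighbour_symmetry :
  ~ has_neighbour_symmetry (@ghz 2) Zrep (fun _ => 1%:M).
Proof.
(* A single $Z$ negates the amplitude of $|1\dots1\rangle$ at any length; 2 is the least one
   allowed. *)
move=> /(_ 2%N isT 0 true) /ffunP /(_ [ffun=> 1]); apply/eqP.
rewrite on_site_diag -diag_const_mx on_site_diag mps_ghz_const // ffunE.
by rewrite !mxE !mulr1 expr1 eq_sym -addr_eq0 -mulr2n pnatr_eq0.
Qed.

End Operators.

Theorem proposition11 (R : realType) :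
  exists (G : topologicalGroupType) (D dA dB : nat)
         (A : 'I_dA -> 'M[R[i]]_D) (B : 'I_dB -> 'M[R[i]]_D)
         (T : G -> 'M[R[i]]_dA) (gam del : G -> G -> R[i])
         (Rr L : G -> 'M[R[i]]_dB),
    finite_or_compact_Lie R G /\
    is_unitary_rep T /\
    is_proj_unitary_rep gam Rr /\
    is_proj_unitary_rep del L /\
    (forall g h : G, del g h = (gam g h)^-1) /\
    has_local_symmetry A B Rr T L /\
    ~ has_global_symmetry A T /\
    ~ has_neighbour_symmetry B Rr L.
Proof.
exists Z2, 2, 2, 2, (@ghz R 2), (@ghz R 2), (@Zrep R), (fun _ _ => 1).
exists (fun _ _ => 1), (@Zrep R), (fun _ => 1%:M).
split; first by left; exact: finite_finset.
do 3 (split; first by [exact: Zrep_unitary | exact: trivial_rep]).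
split; first by move=> g h; rewrite invr1.
split; first exact: ghz_local_symmetry.
by split; [exact: ghz_no_global_symmetry | exact: ghz_no_neighbour_symmetry].
Qed.
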